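(* For every $k\ge 2$, it holds that $k\text{-DIR}\subseteq k_{\mathrm{DIR}}\text{-CONV}$.
   Context: All graphs are finite. A polygon is a closed convex polygon in $\mathbb{R}^2$. For a finite collection of sets, its intersection graph has one vertex for each member of the collection, and two distinct vertices are adjacent iff the corresponding sets have nonempty intersection. $k\text{-DIR}$ is the class of intersection graphs of finite collections of straight-line segments in the plane in which all segments are parallel to at most $k$ directions. For a set $L$ of $k$ distinct lines through the origin in $\mathbb{R}^2$, $\mathcal{P}(L)$ is the family of all polygons each of whose sides is parallel to some line of $L$; $k_{\mathrm{DIR}(L)}\text{-CONV}$ is the class of intersection graphs of finite collections of polygons from $\mathcal{P}(L)$, and $k_{\mathrm{DIR}}\text{-CONV}$ is the union of $k_{\mathrm{DIR}(L)}\text{-CONV}$ over all sets $L$ of $k$ distinct lines through the origin. *)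

(* Defs.v *)
From mathcomp Require Import all_boot all_order all_algebra.
From mathcomp Require Import all_classical all_reals all_analysis.

Set Implicit Arguments.
Unset Strict Implicit.
Unset Printing Implicit Defensive.

Import Order.TTheory GRing.Theory Num.Theory.
Import numFieldNormedType.Exports.

Local Open Scope classical_set_scope.
Local Open Scope card_scope.
Local Open Scope ring_scope.
Local Open Scope convex_scope.

Record sgraph := SGraph {
  vertex : finType;
  adj : rel vertex;
  adj_sym : symmetric adj;
  adj_irrefl : irreflexive adj }.

(* Collections of sets are indexed families, so members may coincide as sets;
   since the index type is the vertex type itself, the class is closed under
   graph isomorphism.  Graph classes are predicates rather than elements of
   [set sgraph], which would be a universe inconsistency. *)
Definition intersection_graphs (T : Type) (F : set (set T)) (G : sgraph) : Prop :=
  exists f : vertex G -> set T,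
    (forall v, F (f v)) /\
    (forall u v, u != v -> adj u v <-> f u `&` f v !=set0).

Section Plane.
Context {R : realType}.
Local Notation plane := 'rV[R]_2.
Local Notation line := {vspace plane}.
Implicit Types (L : set line) (l : line) (A P S V : set plane).

Definition lines0 : set line := [set l | \dim l = 1%N].

Definition seg (a b : plane) : set plane :=
  [set (a : convex_lmodType plane) <| t |> b | t in [set: {i01 R}]].

Definition segment S := exists a b : plane, a != b /\ S = seg a b.

Definition parallel S l := forall x y, S x -> S y -> y - x \in l.

Definition convex_hull A : set plane := smallest (@convex_set R plane) A.

(* Polygons are two-dimensional: a segment or a point is not a polygon. *)
Definition polygon P :=
  (exists V, finite_set V /\ P = convex_hull V) /\ interior P !=set0.

(* The sides are the nondegenerate segments cut out of the boundary by the
   supporting lines. *)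
Definition side P S :=
  segment S /\
  exists (n : 'cV[R]_2) (c : R),
    [/\ n != 0,
        forall x, P x -> (x *m n) 0 0 <= c
      & S = P `&` [set x | (x *m n) 0 0 = c]].

Definition segments_along L : set (set plane) :=
  [set S | segment S /\ exists2 l, L l & parallel S l].

Definition polygons_along L : set (set plane) :=
  [set P | polygon P /\ forall S, side P S -> exists2 l, L l & parallel S l].

End Plane.

Definition DIR (R : realType) (k : nat) (G : sgraph) : Prop :=
  exists L : set {vspace 'rV[R]_2},
    [/\ L `<=` lines0, L #<= `I_k & intersection_graphs (segments_along L) G].

Definition DIR_L_CONV (R : realType) (L : set {vspace 'rV[R]_2}) (G : sgraph)
    : Prop :=
  intersection_graphs (polygons_along L) G.

Definition DIR_CONV (R : realType) (k : nat) (G : sgraph) : Prop :=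
  exists L : set {vspace 'rV[R]_2},
    [/\ L `<=` lines0, L #= `I_k & DIR_L_CONV L G].

(* Main.v *)
(* Enlarge the directions used by the segments to a set L of exactly k lines.
   Since k >= 2, the segment [a, b] can be swept along a direction e of L other
   than its own, giving the parallelogram spanned at a by b - a and eps *: e,
   whose sides follow two lines of L.  It contains [a, b], so intersections
   survive; disjoint segments are compact, hence at positive distance, and none
   of the finitely many pairs meets after the sweep once eps is small. *)
Require Import Defs.
From mathcomp Require Import all_boot all_order all_algebra.
From mathcomp Require Import all_classical all_reals all_analysis.
From mathcomp Require Import ring lra.

Set Implicit Arguments.
Unset Strict Implicit.
Unset Printing Implicit Defensive.

Import Order.TTheory GRing.Theory Num.Theory.
Import numFieldNormedType.Exports.

Local Open Scope classical_set_scope.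
Local Open Scope card_scope.
Local Open Scope ring_scope.

(** [DIR] allows fewer than [k] lines while [DIR_CONV] asks for exactly [k]; since [A] is infinite,
    the missing elements can be added to [B] one at a time. *)
Lemma superset_card_eqI (T : choiceType) (A B : set T) (k : nat) :
  infinite_set A -> B `<=` A -> B #<= `I_k ->
  exists C, [/\ B `<=` C, C `<=` A & C #= `I_k].
Proof.
move=> Ainf BA Bk.
have /finite_setP[m Bm] : finite_set B by apply/finite_set_leP; exists k.
have mk : (m <= k)%N by rewrite -card_le_II -(card_le_eql Bm).
rewrite -(subnKC mk); elim: (k - m)%N => [|d [C [BC CA Cd]]].
  by exists B; split; rewrite ?addn0.
have Cfin : finite_set C by apply/finite_setP; exists (m + d)%N.
have /infinite_setN0[x [Ax nCx]] := infinite_setD Ainf Cfin.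
exists (x |` C); split.
- by move=> y /BC; right.
- by move=> y [->|/CA].
- rewrite addnS; apply/eq_cardSP; exists x; first by left.
  by rewrite setUKD// => y [->].
Qed.

Section Plane.
Context {R : realType}.
Local Notation plane := 'rV[R]_2.
Implicit Types (p u v x y : plane) (s t : R).

(** * Coordinates, lines and segments in the plane *)

Lemma row2P x y : x 0 0 = y 0 0 -> x 0 1 = y 0 1 -> x = y.
Proof.
move=> e0 e1; apply/rowP => -[[|[|//]] i].
- by rewrite (_ : Ordinal i = 0)//; apply/val_inj.
- by rewrite (_ : Ordinal i = 1)//; apply/val_inj.
Qed.

Definition det2 u v : R := u 0 0 * v 0 1 - u 0 1 * v 0 0.

Lemma det2Zr u v (c : R) : det2 u (c *: v) = c * det2 u v.
Proof. by rewrite /det2 !mxE; ring. Qed.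

Lemma det2_eq0 u v : u != 0 -> det2 u v = 0 -> v \in <[u]>%VS.
Proof.
rewrite /det2 => u0 /eqP; rewrite subr_eq0 => /eqP uv; apply/vlineP.
have [u00|u00] := eqVneq (u 0 0) 0.
  have u01 : u 0 1 != 0.
    by apply: contra u0 => /eqP u01; apply/eqP/row2P; rewrite mxE.
  exists (v 0 1 / u 0 1); apply: row2P; rewrite !mxE ?divfK// u00 mulr0.
  move: uv; rewrite u00 mul0r => /esym/eqP.
  by rewrite mulf_eq0 (negbTE u01) => /eqP.
exists (v 0 0 / u 0 0); apply: row2P; rewrite !mxE ?divfK//.
by apply: (mulfI u00); rewrite uv; field.
Qed.

(** The lines spanned by [(1, m)], for natural [m], have pairwise distinct slopes. *)
Lemma infinite_lines0 : infinite_set (@lines0 R).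
Proof.
pose w (m : nat) : plane := \row_j (if j == 0 then 1 else m%:R).
have w0 m : w m 0 0 = 1 by rewrite mxE.
have w1 m : w m 0 1 = m%:R by rewrite mxE.
apply/infiniteP; suff [f] : $|{injfun [set: nat] >-> @lines0 R}|.
  exact: inj_card_le f.
apply/injfunPex; exists (fun m => <[w m]>%VS).
  move=> m _; rewrite /lines0/= dim_vline; case: eqP => // /rowP/(_ 0).
  by rewrite w0 mxE => /eqP; rewrite oner_eq0.
move=> m m' _ _ mm'; have : w m \in <[w m']>%VS by rewrite -mm' memv_line.
move=> /vlineP[c wE].
have wiE i : w m 0 i = c * w m' 0 i by rewrite wE mxE.
move: (wiE 0) (wiE 1); rewrite !w0 !w1 mulr1 => <- /eqP.
by rewrite mul1r eqr_nat => /eqP.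
Qed.

Lemma convE (a b : plane) (l : {i01 R}) :
  conv l (a : convex_lmodType plane) b
  = l%:num *: a + (1 - l%:num) *: b :> plane.
Proof. by []. Qed.

Lemma segE (a b : plane) :
  seg a b = [set a + s *: (b - a) | s in `[0, 1]].
Proof.
apply/seteqP; split => [_ [t _ <-]|_ [s /= + <-]].
  (* [conv] puts the weight [t] on [a], so the parameter along [b - a] is [1 - t]. *)
  exists (1 - t%:num).
    by rewrite /= in_itv/= subr_ge0 lerBlDr lerDl ge0 le1.
  rewrite convE; apply: row2P; rewrite !mxE /=; ring.
rewrite in_itv/= => /andP[s0 s1].
have t0 : 0 <= 1 - s by rewrite subr_ge0.
have t1 : 1 - s <= 1 by rewrite lerBlDr lerDl.
exists (Itv01 t0 t1) => //.
rewrite convE; apply: row2P; rewrite !mxE /=; ring.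
Qed.

(** * Parallelograms as polygons, and their sides *)

Definition parallelogram p u v : set plane :=
  [set p + st.1 *: u + st.2 *: v | st in `[0, 1] `*` `[0, 1]].

Lemma parallelogramP p u v x :
  parallelogram p u v x <->
  exists s t, [/\ 0 <= s <= 1, 0 <= t <= 1 & x = p + s *: u + t *: v].
Proof.
split=> [[[s t] /= [+ +] <-]|[s [t [sI tI ->]]]].
  by rewrite !in_itv/= => sI tI; exists s, t.
by exists (s, t) => //; split; rewrite /= in_itv.
Qed.

Lemma parallelogramC p u v : parallelogram p u v = parallelogram p v u.
Proof.
by apply/seteqP; split => x /parallelogramP[s [t [sI tI ->]]];
  apply/parallelogramP; exists t, s; rewrite addrAC.
Qed.

Lemma parallelogram_hull p u v :
  parallelogram p u v =
  convex_hull [set p; p + u; p + v; p + u + v].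
Proof.
apply/seteqP; split.
  move=> x /parallelogramP[s [t [/andP[s0 s1] /andP[t0 t1] ->]]] M [cM VM].
  pose conv01 (a b : plane) r (r0 : 0 <= r) (r1 : r <= 1) :=
    conv (Itv01 r0 r1) (a : convex_lmodType plane) b : plane.
  have hM a b r r0 r1 : M a -> M b -> M (@conv01 a b r r0 r1).
    by move=> Ma Mb; apply/set_mem/cM; apply/mem_set.
  (* Bilinear interpolation: first along the two edges parallel to [u], with weight [s], then
     between the points obtained, with weight [t]. *)
  have -> : p + s *: u + t *: v =
     conv01 (conv01 (p + u + v) (p + v) _ s0 s1)
            (conv01 (p + u) p _ s0 s1) _ t0 t1.
    rewrite /conv01 !convE; apply: row2P; rewrite !mxE /=; ring.
  by apply: (hM); apply: (hM); apply: VM => /=; tauto.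
apply: smallest_sub.
  move=> x y l /set_mem/parallelogramP[s [t [sI tI ->]]].
  move=> /set_mem/parallelogramP[s' [t' [sI' tI' ->]]].
  apply/mem_set/parallelogramP.
  have l0 : 0 <= l%:num by exact: ge0.
  have l1 : l%:num <= 1 by exact: le1.
  exists (l%:num * s + (1 - l%:num) * s'), (l%:num * t + (1 - l%:num) * t').
  split; [nra|nra|].
  rewrite convE; apply: row2P; rewrite !mxE /=; ring.
move=> x /= [[[]|]|] ->; apply/parallelogramP.
- by exists 0, 0; rewrite !scale0r !addr0 lexx ler01.
- by exists 1, 0; rewrite scale0r scale1r addr0 !lexx ler01.
- by exists 0, 1; rewrite scale0r scale1r addr0 !lexx ler01.
- by exists 1, 1; rewrite !scale1r !lexx ler01.
Qed.

Lemma continuous_affine (a b c : R) :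
  continuous (fun x : plane => a * x 0 0 + b * x 0 1 + c).
Proof.
have coordZ (k : R) (j : 'I_2) : continuous (cst k \* fun x : plane => x 0 j).
  move=> x; apply: continuousM; [exact: cst_continuous|exact: coord_continuous].
have -> : (fun x : plane => a * x 0 0 + b * x 0 1 + c) =
    ((cst a \* fun x : plane => x 0 0) + (cst b \* fun x : plane => x 0 1)
     + cst c).
  by apply/funext.
move=> x; apply: continuousD; last exact: cst_continuous.
by apply: continuousD; exact: coordZ.
Qed.

(** The points with both coordinates strictly between 0 and 1 form an open set containing the
    centre. *)
Lemma interior_parallelogram p u v :
  det2 u v != 0 -> interior (parallelogram p u v) !=set0.
Proof.
move=> D0; pose D := det2 u v.
(* Cramer's rule: s and t are the coordinates of x - p in the basis u, v. *)
pose s x := v 0 1 / D * x 0 0 + (- v 0 0 / D) * x 0 1 + - (det2 p v / D).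
pose t x := - u 0 1 / D * x 0 0 + (u 0 0 / D) * x 0 1 + - (det2 u p / D).
pose U := s @^-1` `]0, 1[ `&` t @^-1` `]0, 1[.
have oU : open U.
  by apply: openI; apply: open_comp => // x _; exact: continuous_affine.
have UP : U `<=` parallelogram p u v.
  move=> x [/=]; rewrite !in_itv/= => /andP[s0 s1] /andP[t0 t1].
  apply/parallelogramP; exists (s x), (t x); split; rewrite ?ltW//.
  by apply: row2P; rewrite /s /t /D /det2 !mxE; field; exact: D0.
exists (p + 2^-1 *: u + 2^-1 *: v).
rewrite open_subsetE// in UP; apply: UP.
have half : (2^-1 : R) \in `]0, 1[ by rewrite in_itv/=; lra.
split; rewrite /= [X in X \in _](_ : _ = 2^-1) //.
- by rewrite /s /D /det2 !mxE; field; exact: D0.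
- by rewrite /t /D /det2 !mxE; field; exact: D0.
Qed.

Lemma polygon_parallelogram p u v :
  det2 u v != 0 -> polygon (parallelogram p u v).
Proof.
move=> D0; split; last exact: interior_parallelogram.
exists [set p; p + u; p + v; p + u + v]; split.
  by rewrite !finite_setU; do !split; exact: finite_set1.
exact: parallelogram_hull.
Qed.

(* On the part of the parallelogram where the functional n is maximal, the
   coordinate along u is frozen at 0 or 1 as soon as n does not vanish on u. *)
Lemma parallelogram_argmax p u v (n : 'cV[R]_2) (c : R) :
  (forall x, parallelogram p u v x -> (x *m n) 0 0 <= c) ->
  (u *m n) 0 0 != 0 ->
  forall x y, parallelogram p u v x -> (x *m n) 0 0 = c ->
    parallelogram p u v y -> (y *m n) 0 0 = c -> y - x \in <[v]>%VS.
Proof.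
move=> maxc un0.
(* [s1] is the end of the unit interval where the functional is larger along [u]. *)
pose s1 : R := if 0 < (u *m n) 0 0 then 1 else 0.
have frozen x : parallelogram p u v x -> (x *m n) 0 0 = c ->
    exists t, x = p + s1 *: u + t *: v.
  move=> /parallelogramP[s [t [sI tI ->]]] xc; exists t.
  (* Replacing [s] by [s1] with [t] fixed cannot raise the value above the maximum [c], which forces
     [s = s1]. *)
  have /maxc : parallelogram p u v (p + s1 *: u + t *: v).
    apply/parallelogramP; exists s1, t; split => //.
    by rewrite /s1; case: ifP => _; rewrite !lexx ler01.
  rewrite -xc !mulmxDl -!scalemxAl !mxE; move: un0; rewrite /s1.
  rewrite !mxE; set a := \sum_(_ < _) _.
  set b := \sum_(_ < _) v _ _ * _ => a0.
  case: ltgtP a0 => // a0 _ H.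
    by have -> : s = 1 by nra.
  by have -> : s = 0 by nra.
move=> x y /frozen/[apply] -[t ->] /frozen/[apply] -[t' ->].
by apply/vlineP; exists (t' - t); apply: row2P; rewrite !mxE; ring.
Qed.

Lemma mulmx_row2 u (n : 'cV[R]_2) :
  (u *m n) 0 0 = u 0 0 * n 0 0 + u 0 1 * n 1 0.
Proof.
rewrite mxE big_ord_recl big_ord1.
by congr (_ + u _ _ * n _ _); exact/val_inj.
Qed.

(** A nonzero functional cannot vanish on both [u] and [v], which form a basis; if it is nonzero on
    one of them, the side follows the other. *)
Lemma parallel_side_parallelogram p u v (S : set plane) : det2 u v != 0 ->
  side (parallelogram p u v) S ->
  parallel S <[u]>%VS \/ parallel S <[v]>%VS.
Proof.
move=> D0 [_ [n [c [n0 maxc ->]]]].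
have [un0|un0] := eqVneq ((u *m n) 0 0) 0; last first.
  by right=> x y [Px xc] [Py yc]; exact: (parallelogram_argmax maxc).
left=> x y [Px xc] [Py yc].
rewrite parallelogramC in maxc Px Py.
apply: (parallelogram_argmax maxc) => //.
apply: contra_neq n0 => vn0; move: un0 vn0; rewrite !mulmx_row2 => un0 vn0.
(* Cramer's rule for the system [u *m n = 0], [v *m n = 0], with determinant [det2 u v]. *)
have n00 : n 0 0 = 0.
  apply: (mulfI D0); rewrite mulr0; transitivity
    (v 0 1 * (u 0 0 * n 0 0 + u 0 1 * n 1 0)
     - u 0 1 * (v 0 0 * n 0 0 + v 0 1 * n 1 0)).
    by rewrite /det2; ring.
  by rewrite un0 vn0 !mulr0 subr0.
have n10 : n 1 0 = 0.
  apply: (mulfI D0); rewrite mulr0; transitivity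
    (u 0 0 * (v 0 0 * n 0 0 + v 0 1 * n 1 0)
     - v 0 0 * (u 0 0 * n 0 0 + u 0 1 * n 1 0)).
    by rewrite /det2; ring.
  by rewrite un0 vn0 !mulr0 subr0.
by apply/trmx_inj/row2P; rewrite !mxE.
Qed.

(** * Sweeping segments, and keeping disjoint ones apart *)

Lemma dim1_line l u : \dim l = 1 -> u \in l -> u != 0 -> l = <[u]>%VS.
Proof.
move=> l1 ul u0; apply/esym/eqP.
by rewrite eqEdim -memvE ul l1 dim_vline u0.
Qed.

(** The sweep vector is chosen before [eps], so that one [eps] can later serve all segments. *)
Lemma segments_along_slab (L : set {vspace plane}) k (S : set plane) :
  L `<=` @lines0 R -> L #= `I_k -> (2 <= k)%N -> segments_along L S ->
  exists abe : plane * plane * plane,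
    S = seg abe.1.1 abe.1.2 /\ forall eps, 0 < eps ->
      polygons_along L
        (parallelogram abe.1.1 (abe.1.2 - abe.1.1) (eps *: abe.2)).
Proof.
move=> Ll Lk k2 [[a [b [ab Sab]]] [l Ll0 Sl]].
(* Of two distinct lines of [L], at least one differs from [l]. *)
have [l' Ll' ll'] : exists2 l', L l' & l' != l.
  move: k2 Lk; case: k => [|[|k]]// _.
  move=> /eq_cardSP[l1 Ll1 /eq_cardSP[l2 [Ll2 l21] _]].
  have [e|] := eqVneq l1 l; last by exists l1.
  by exists l2 => //; rewrite -e; apply/eqP.
have d0 : b - a != 0 by rewrite subr_eq0 eq_sym.
have dl : b - a \in l.
  apply: Sl; rewrite Sab segE.
    by exists 0; rewrite ?scale0r ?addr0//= in_itv/= lexx ler01.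
  by exists 1; rewrite ?scale1r ?subrKC//= in_itv/= lexx ler01.
pose e := vpick l'; have el' : e \in l' := memv_pick l'.
have e0 : e != 0 by rewrite vpick0 -dimv_eq0 (Ll _ Ll').
have lE := dim1_line (Ll _ Ll0) dl d0.
have l'E := dim1_line (Ll _ Ll') el' e0.
have De : det2 (b - a) e != 0.
  apply: contra_neq ll' => /(det2_eq0 d0); rewrite -lE => el.
  by rewrite l'E -(dim1_line (Ll _ Ll0) el e0).
exists (a, b, e); split => //= eps eps0.
have Deps : det2 (b - a) (eps *: e) != 0.
  by rewrite det2Zr mulf_neq0// lt0r_neq0.
split; first exact: polygon_parallelogram.
move=> T /(parallel_side_parallelogram Deps)[Td|Te].
  by exists l => //; rewrite lE.
exists l' => // x y Tx Ty; have /vlineP[c ->] := Te x y Tx Ty.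
by rewrite !memvZ.
Qed.

Lemma seg_sub_parallelogram (a b e : plane) :
  seg a b `<=` parallelogram a (b - a) e.
Proof.
rewrite segE => _ [s /= + <-]; rewrite in_itv/= => sI.
by apply/parallelogramP; exists s, 0; rewrite scale0r addr0 lexx ler01.
Qed.

(** The differences between points of the two segments form a compact set avoiding 0, hence a ball
    around 0; a common point of the sweeps would yield a difference of size O([eps]). *)
Lemma disjoint_slabs_near (a b e a' b' e' : plane) :
  seg a b `&` seg a' b' = set0 ->
  \forall eps \near 0^'+,
    parallelogram a (b - a) (eps *: e) `&`
    parallelogram a' (b' - a') (eps *: e') = set0.
Proof.
rewrite !segE => disj.
pose f (z : R * R) : plane := (a - a') + z.1 *: (b - a) - z.2 *: (b' - a').
have fc : continuous f.
  have -> : f = cst (a - a') + (fun z => z.1 *: (b - a))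
                - (fun z => z.2 *: (b' - a')) by apply/funext.
  move=> z; apply: continuousB.
    apply: continuousD; first exact: cst_continuous.
    by apply: continuousZr_tmp; exact: cvg_fst.
  by apply: continuousZr_tmp; exact: cvg_snd.
pose K : set plane := f @` (`[0, 1] `*` `[0, 1]).
have Kc : closed K.
  apply: compact_closed; first exact: norm_hausdorff.
  apply: continuous_compact; first exact: continuous_subspaceT.
  by apply: compact_setX; exact: segment_compact.
have K0 : (~` K) 0.
  move=> [[s t] [/= sI tI]] /eqP; rewrite /f/= subr_eq0 => /eqP st.
  rewrite -[False]/(set0 (a + s *: (b - a))) -disj; split; first by exists s.
  exists t => //; rewrite -st; apply: row2P; rewrite !mxE; ring.
have /nbhs_norm0P[r /= r0 rK] : nbhs (0 : plane) (~` K).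
  by apply: open_nbhs_nbhs; split=> //; exact: closed_openC.
(* The summand 1 keeps the later divisor positive even when [e] and [e'] vanish. *)
have M0 : 0 < `|e| + `|e'| + 1 by rewrite ltr_wpDl// addr_ge0.
near=> eps.
have eps0 : 0 < eps by near: eps; exact: nbhs_right_gt.
rewrite -subset0 => x [/parallelogramP[s [t [sI /andP[t0 t1] xst]]]].
move=> /parallelogramP[s' [t' [s'I /andP[t'0 t'1] xst']]].
(* Equating the two expressions of [x] shows that this small vector is [f (s, s')], a point of
   [K]. *)
apply: (rK ((t' * eps) *: e' - (t * eps) *: e)).
  have nZ c x0 : 0 <= c -> `|c *: x0 : plane| = c * `|x0|.
    by move=> c0; rewrite normrZ ger0_norm.
  rewrite /= (le_lt_trans (ler_normB _ _))// !nZ ?mulr_ge0 ?(ltW eps0)//.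
  apply: (@le_lt_trans _ _ (eps * (`|e| + `|e'| + 1))).
    rewrite !mulrDr mulr1 ler_wpDr ?(ltW eps0)// addrC -!mulrA.
    by apply: lerD; rewrite ler_piMl ?mulr_ge0 ?(ltW eps0).
  by rewrite -ltr_pdivlMr//; near: eps; apply: nbhs_right_lt; rewrite divr_gt0.
exists (s, s'); first by split; rewrite /= in_itv.
rewrite /f /=; move: xst; rewrite xst' => /esym/eqP.
rewrite -subr_eq0 => /eqP H.
apply/eqP; rewrite -subr_eq0 -H; apply/eqP/row2P; rewrite !mxE; ring.
Unshelve. all: by end_near. Qed.

End Plane.

Theorem theorem1 (R : realType) (k : nat) (hk : (2 <= k)%N) :
  forall G : sgraph, DIR R k G -> DIR_CONV R k G.
Proof.
move=> G [L0 [L0l L0k [f [fL fadj]]]].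
have [L [L0L Ll Lk]] := superset_card_eqI (@infinite_lines0 R) L0l L0k.
have fL' v : segments_along L (f v).
  by have [Sv [l L0l' Svl]] := fL v; split => //; exists l => //; exact: L0L.
have /choice[g gP] := fun v => segments_along_slab Ll Lk hk (fL' v).
pose P eps v :=
  parallelogram (g v).1.1 ((g v).1.2 - (g v).1.1) (eps *: (g v).2).
exists L; split => //.
have sep : \forall eps \near (0 : R)^'+,
    forall u v, f u `&` f v = set0 -> P eps u `&` P eps v = set0.
  (* There are finitely many pairs of vertices, so [eps] may be treated pair by pair. *)
  apply: filter_forall => u; apply: filter_forall => v.
  have [fuv|fuv] := pselect (f u `&` f v = set0); last exact: nearW.
  have := fuv; rewrite (gP u).1 (gP v).1 => /disjoint_slabs_near sl.
  by apply: filterS (sl (g u).2 (g v).2) => eps.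
have /filter_ex[eps [eps0 epsP]] : \forall eps \near (0 : R)^'+,
    0 < eps /\ forall u v, f u `&` f v = set0 -> P eps u `&` P eps v = set0.
  by near=> eps; split; near: eps; [exact: nbhs_right_gt|exact: sep].
exists (P eps); split=> [v|u v uv]; first exact: (gP v).2.
rewrite fadj//; split=> [[x [fux fvx]]|].
  rewrite (gP u).1 in fux; rewrite (gP v).1 in fvx.
  by exists x; split; exact: seg_sub_parallelogram.
(* Disjoint segments have disjoint sweeps by the choice of [eps]. *)
apply: contraPP => /nonemptyPn/epsP ->; exact/nonemptyPn.
Unshelve. all: by end_near. Qed.
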